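(* Let $\alpha \in [\frac{1}{2}, 1)$ and let $n,k$ be integers with $1\leq k \leq n-7$. Then, among all graphs in $\mathscr{T}_n^{k}$, the graph $\mathcal{T}_3$ is the unique graph (up to isomorphism) with the largest $A_{\alpha}$-spectral radius; that is, $\rho_\alpha(G) < \rho_\alpha(\mathcal{T}_3)$ for every $G \in \mathscr{T}_n^k$ not isomorphic to $\mathcal{T}_3$.
   Context: All graphs are finite, simple and undirected. For a graph $G$ with adjacency matrix $A(G)$ and diagonal degree matrix $D(G)$, and $\alpha\in[0,1]$, the $A_\alpha$-matrix is $A_\alpha(G)=\alpha D(G)+(1-\alpha)A(G)$, and the $A_\alpha$-spectral radius $\rho_\alpha(G)$ is the largest eigenvalue of $A_\alpha(G)$. A tricyclic graph of order $n$ is a connected simple graph with $n$ vertices and $n+2$ edges. A pendant vertex is a vertex of degree $1$. For positive integers $n,k$, $\mathscr{T}_n^k$ denotes the set of all tricyclic graphs of order $n$ with exactly $k$ pendant vertices. Attaching $k$ paths of nearly equal lengths to a vertex $v$ of a graph $H$ (to obtain a graph of order $n$) means: add $k$ new paths, each of length at least $1$, each having $v$ as one endpoint and otherwise consisting of new vertices, pairwise sharing only $v$, whose lengths pairwise differ by at most $1$, and whose total number of new vertices is $n-|V(H)|$. The graph $\mathcal{T}_3\in\mathscr{T}_n^k$ is obtained from three triangles sharing exactly one common vertex $v$ (a graph on $7$ vertices) by attaching $k$ paths of nearly equal lengths to $v$. *)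

(* Defs.v *)
From HB Require Import structures.
From mathcomp Require Import all_boot all_order all_algebra.
From mathcomp Require Import all_classical all_reals.
From mathcomp Require Import complex.

Set Implicit Arguments.
Unset Strict Implicit.
Unset Printing Implicit Defensive.

Import Order.TTheory GRing.Theory Num.Theory.
Local Open Scope ring_scope.

Record sgraph := SGraph {
  vertex :> finType;
  adj : rel vertex;
  adj_sym : symmetric adj;
  adj_irr : irreflexive adj }.

Definition deg (G : sgraph) (x : G) : nat := #|[set y | adj x y]|.

Definition edges (G : sgraph) : {set {set G}} :=
  [set [set p.1; p.2] | p in [set p : G * G | adj p.1 p.2]].

Definition connected_graph (G : sgraph) : Prop :=
  (0 < #|G|)%N /\ forall x y : G, connect (@adj G) x y.

Definition isomorphic (G H : sgraph) : Prop :=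
  exists2 f : G -> H, bijective f & forall x y, adj (f x) (f y) = adj x y.

Definition tricyclic (n : nat) (G : sgraph) : Prop :=
  [/\ #|G| = n, connected_graph G & #|edges G| = (n + 2)%N].

Definition tricyclic_pendant (n k : nat) (G : sgraph) : Prop :=
  tricyclic n G /\ #|[set x : G | deg x == 1%N]| = k.

Section Spectrum.
Variable R : realType.

Definition adjacency_mx (G : sgraph) : 'M[R]_#|G| :=
  \matrix_(i, j) (adj (enum_val i) (enum_val j))%:R.

Definition degree_mx (G : sgraph) : 'M[R]_#|G| :=
  diag_mx (\row_i (deg (enum_val i))%:R).

Definition Aalpha (alpha : R) (G : sgraph) : 'M[R]_#|G| :=
  alpha *: degree_mx G + (1 - alpha) *: adjacency_mx G.

(* The supremum is attained whenever [M] is symmetric and [0 < n]: see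
   [largest_eigenvalueP]. *)
Definition largest_eigenvalue n (M : 'M[R]_n) : R :=
  sup [set a | eigenvalue M a]%classic.

Definition rho (alpha : R) (G : sgraph) : R :=
  largest_eigenvalue (Aalpha alpha G).

Lemma poly_roots_seq (p : {poly R}) : p != 0 ->
  exists s : seq R, forall x, root p x = (x \in s).
Proof.
have [m] := ubnP (size p); elim: m p => // m IH p sp p0.
have [[a ra]|nr] := pselect (exists a, root p a); last first.
  exists [::] => x; rewrite in_nil; apply/negbTE/negP => rx.
  by apply: nr; exists x.
have /factor_theorem [q pq] := ra.
have q0 : q != 0 by apply: contraNneq p0 => q0; rewrite pq q0 mul0r.
have [|s hs] := IH q _ q0.
  by move: sp; rewrite pq size_Mmonic ?monicXsubC// size_XsubC addn2.
exists (a :: s) => x.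
by rewrite pq rootM root_XsubC in_cons hs orbC.
Qed.

Lemma symmetric_eigenvalue n (M : 'M[R]_n) : (0 < n)%N -> M^T = M ->
  exists a, eigenvalue M a.
Proof.
move=> n0 symM; pose C : numClosedFieldType := complex R.
pose c : {rmorphism R -> C} := real_complex R.
have [a ea] := eigenvalue_closed (map_mx c M : 'M[C]_n) n0.
have /eigenvalueP [v vM v0] := ea.
pose w := map_mx Num.conj v^T.
have cM : map_mx Num.conj (map_mx c M) = map_mx c M.
  apply/matrixP => i j; rewrite !mxE; apply/CrealP.
  by apply/complex_realP; exists (M i j).
have Mw : map_mx c M *m w = Num.conj a *: w.
  have := congr1 (fun u => map_mx Num.conj u^T) vM.
  rewrite trmx_mul map_mxM /= map_trmx symM cM => ->.
  by apply/matrixP => i j; rewrite !mxE rmorphM.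
have vw : (v *m w) 0 0 != 0.
  rewrite mxE; apply: contra v0; rewrite psumr_eq0; last first.
    by move=> i _; rewrite !mxE mul_conjC_ge0.
  move=> /allP h; apply/eqP/rowP => i; rewrite !mxE.
  by have := h i (mem_index_enum i); rewrite /= !mxE mul_conjC_eq0 => /eqP.
have aR : a \is Num.real.
  apply/CrealP; apply: (mulIf vw).
  have := mulmxA v (map_mx c M) w.
  rewrite vM Mw -scalemxAl -scalemxAr => /matrixP/(_ 0 0).
  by rewrite !mxE.
have /complex_realP [b ab] := aR.
exists b; move: ea; rewrite !eigenvalue_root_char ab.
by rewrite -map_char_poly fmorph_root.
Qed.

Lemma largest_eigenvalueP n (M : 'M[R]_n) : (0 < n)%N -> M^T = M ->
  eigenvalue M (largest_eigenvalue M) /\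
  forall a, eigenvalue M a -> a <= largest_eigenvalue M.
Proof.
move=> n0 symM; have [a ea] := symmetric_eigenvalue n0 symM.
have [s hs] := poly_roots_seq (monic_neq0 (char_poly_monic M)).
have es x : eigenvalue M x = (x \in s) by rewrite eigenvalue_root_char hs.
pose b := \big[Num.max/a]_(x <- s) x.
have ub x : eigenvalue M x -> x <= b.
  by rewrite es => xs; apply: le_bigmax_seq.
have eb : eigenvalue M b.
  rewrite /b big_seq; elim/big_ind: _ => //.
    by move=> x y hx hy; case: (leP x y).
  by move=> x; rewrite es.
suff -> : largest_eigenvalue M = b by [].
apply/eqP; rewrite eq_le; apply/andP; split.
  by apply: ge_sup; [exists a | move=> x; exact: ub].
by apply: ub_le_sup => //; exists b => x; exact: ub.
Qed.

Lemma Aalpha_sym (alpha : R) (G : sgraph) : (Aalpha alpha G)^T = Aalpha alpha G.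
Proof.
rewrite /Aalpha linearD !linearZ /= tr_diag_mx; congr (_ + _ *: _).
by apply/matrixP => i j; rewrite !mxE adj_sym.
Qed.

Lemma rhoP (alpha : R) (G : sgraph) : (0 < #|G|)%N ->
  eigenvalue (Aalpha alpha G) (rho alpha G) /\
  forall a, eigenvalue (Aalpha alpha G) a -> a <= rho alpha G.
Proof. by move=> G0; apply: largest_eigenvalueP => //; exact: Aalpha_sym. Qed.

End Spectrum.

Section AttachPaths.
Variables (H : sgraph) (v : H) (k : nat) (l : 'I_k -> nat).

(* [inr (Tagged _ j)] with tag [i] is the vertex at distance [j + 1] from [v]
   on the [i]-th attached path, which has length [l i]. *)
Definition attach_vertex : finType := (H + {i : 'I_k & 'I_(l i)})%type.

Definition attach_adj : rel attach_vertex := fun x y =>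
  match x, y with
  | inl a, inl b => adj a b
  | inl a, inr q => (a == v) && (tagged q == 0 :> nat)
  | inr p, inl b => (b == v) && (tagged p == 0 :> nat)
  | inr p, inr q => (tag p == tag q) &&
      (((tagged p).+1 == tagged q :> nat) || ((tagged q).+1 == tagged p :> nat))
  end.

Lemma attach_sym : symmetric attach_adj.
Proof.
by move=> [a|p] [b|q] //=; [exact: adj_sym | rewrite eq_sym orbC].
Qed.

Lemma attach_irr : irreflexive attach_adj.
Proof.
move=> [a|p] /=; first exact: adj_irr.
by rewrite eqxx orbb gtn_eqF.
Qed.

Definition attach_paths : sgraph := SGraph attach_sym attach_irr.

Definition nearly_equal_lengths (n : nat) : Prop :=
  [/\ forall i, (1 <= l i)%N,
      forall i j, (l i <= l j + 1)%N
    & (\sum_i l i = n - #|H|)%N].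

End AttachPaths.

(* [None] is the common vertex; the [i]-th triangle consists of [None],
   [Some (i, false)] and [Some (i, true)]. *)
Definition three_triangles_adj : rel (option ('I_3 * bool)) := fun x y =>
  match x, y with
  | None, None => false
  | Some p, Some q => (p.1 == q.1) && (p.2 != q.2)
  | _, _ => true
  end.

Lemma three_triangles_sym : symmetric three_triangles_adj.
Proof. by move=> [p|] [q|] //=; rewrite eq_sym [p.2 == _]eq_sym. Qed.

Lemma three_triangles_irr : irreflexive three_triangles_adj.
Proof. by move=> [p|] //=; rewrite !eqxx. Qed.

Definition three_triangles : sgraph :=
  SGraph three_triangles_sym three_triangles_irr.

Definition T3 (k : nat) (l : 'I_k -> nat) : sgraph :=
  @attach_paths three_triangles None k l.

Lemma card_three_triangles : #|three_triangles| = 7%N.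
Proof. by rewrite /= card_option card_prod card_ord card_bool. Qed.

Lemma nearly_equal_lengths_exist n k : (1 <= k <= n - 7)%N ->
  exists l : 'I_k -> nat, nearly_equal_lengths three_triangles l n.
Proof.
case/andP => k0 kn; set m := (n - 7)%N in kn.
exists (fun i => m %/ k + (i < m %% k))%N; split.
- by move=> i; rewrite (leq_trans _ (leq_addr _ _))// divn_gt0.
- by move=> i j; rewrite -addnA leq_add2l; case: (_ < _)%N; rewrite ?addn1.
- rewrite card_three_triangles -/m big_split /= sum_nat_const card_ord mulnC.
  rewrite [RHS](divn_eq m k); congr addn.
  have mk : (m %% k <= k)%N by rewrite ltnW// ltn_pmod.
  rewrite -(big_mkord xpredT (fun i => nat_of_bool (i < m %% k)%N)).
  rewrite (big_cat_nat (n := m %% k))//= big_nat (eq_bigr (fun=> 1%N)); last first.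
    by move=> i /andP[_ ->].
  rewrite -big_nat sum_nat_const_nat subn0 muln1 big_nat big1 ?addn0//.
  by move=> i /andP[h _]; rewrite ltnNge h.
Qed.

(* Main.v *)
(* Write a = alpha / (1 - alpha) >= 1, so that A_alpha is (1 - alpha) times
   B = a Deg + A;
   write s + 2 a for an eigenvalue of B, and D for k + 6.  A positive
   vector x with B x <= r x, strictly somewhere, forces every eigenvalue
   to be < r, so it suffices to find such an x on G with (1 - alpha) r <= rho(T3).

   On a pendant path the eigenvalue equation makes the ratios F_l of consecutive
   entries obey F_0 = - a, F_(l+1) = 1 / (s - F_l), a strictly increasing and
   strictly concave sequence for l >= 1.  Hence T3 has a positive eigenvector as
   soon as s + 2 a = a D + 6 / (s - 1) + sum_i F_(l_i), and such an s exists with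
   s + 2 a >= a D + 1 / a by the intermediate value theorem.

   The degree excesses d(u) - 2 of the non-pendant vertices of G add up to D - 2.
   If no vertex has degree D, then x = d (plus 1/2 at a vertex of degree D - 1)
   works.  If v has degree D, all other degrees are at most 2: shortest walks to v
   from the k pendant vertices are disjoint paths, and the remaining vertices have
   degree 2 and contain 6 neighbours of v.  Let x be the path solution on the
   former and 1 / (s - 1) on the latter: the inequality at v is the tangent-line
   inequality for F at the nearly equal lengths, and if no inequality is strict
   then the remaining 6 vertices form three triangles with v, the path lengths
   are those of T3, and G is isomorphic to T3. *)
Require Import Defs.
From mathcomp Require Import all_boot all_order all_algebra.
From mathcomp Require Import all_classical all_reals.
From mathcomp Require Import perm topology normedtype.
From mathcomp Require Import ring lra zify.
Set Implicit Arguments.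
Unset Strict Implicit.
Unset Printing Implicit Defensive.
Import Order.TTheory GRing.Theory Num.Theory.
Import numFieldNormedType.Exports.
Local Open Scope ring_scope.

(** * Supersolutions and degree sums *)

Lemma degE (G : sgraph) (u : G) : deg u = (\sum_(w | adj u w) 1)%N.
Proof. by rewrite sum1_card /deg cardsE; apply: eq_card => w. Qed.

Lemma card_arcs (G : sgraph) :
  #|[set p : G * G | adj p.1 p.2]| = (\sum_(u : G) deg u)%N.
Proof.
rewrite -sum1_card (eq_bigl (fun p : G * G => adj p.1 p.2)); last first.
  by move=> p; rewrite inE.
rewrite -(pair_big_dep xpredT (fun u w : G => adj u w) (fun _ _ => 1%N)) /=.
by apply: eq_bigr => u _; rewrite degE.
Qed.

Lemma sum_deg (G : sgraph) : (\sum_(u : G) deg u = 2 * #|edges G|)%N.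
Proof.
rewrite -card_arcs -sum1_card.
rewrite (partition_big_imset (fun p : G * G => [set p.1; p.2])) /= -/(edges G).
rewrite mulnC -sum_nat_const; apply: eq_bigr => e.
case/imsetP=> -[u w]; rewrite inE /= => uw ->.
have nuw : u != w by apply: contraTneq uw => ->; rewrite adj_irr.
(* The arcs over the edge {u, w} are [(u, w)] and [(w, u)], which differ because there are no
   loops. *)
rewrite (eq_bigl (mem [set (u, w); (w, u)])) ?sum1_card ?cards2.
  by rewrite xpair_eqE (negPf nuw).
move=> [x y]; rewrite !inE /= !xpair_eqE; apply/andP/idP; last first.
  by case/orP=> /andP[/eqP-> /eqP->]; split; rewrite // ?[adj w u]adj_sym // finset.setUC.
case=> xy /eqP/setP E; have nxy : x != y by apply: contraTneq xy => ->; rewrite adj_irr.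
have := E x; have := E y; rewrite !inE !eqxx orbT /=.
move: nxy; case: (y =P u) => [->|_]; case: (x =P u) => [->|_]; rewrite ?eqxx //=.
- by move=> _ _ <-.
- by move=> _ <-.
- by move=> nxy /esym/eqP yw /esym/eqP xw; rewrite xw yw eqxx in nxy.
Qed.

Lemma connected_deg_gt0 (G : sgraph) (u : G) :
  connected_graph G -> (1 < #|G|)%N -> (0 < deg u)%N.
Proof.
move=> [_ conG] G1; rewrite card_gt0.
have [w nuw] : exists w, w != u.
  apply/existsP; apply: contraLR G1; rewrite negb_exists -leqNgt => /forallP h.
  by rewrite -(cards1 u) -cardsT; apply/subset_leq_card/fintype.subsetP => w; rewrite !inE; have := h w; rewrite negbK.
have /connectP[[|z p] /=] := conG u w; first by move=> _ E; rewrite E eqxx in nuw.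
by case/andP=> uz _ _; apply/finset.set0Pn; exists z; rewrite inE.
Qed.

(** * Eigenvalues of A_alpha and the supersolution criterion *)

Section Spectral.
Variables (R : realType) (alpha : R).

(** Row vectors indexed by ordinals become functions on vertices, so that later arguments avoid
    matrices. Symmetry of [adj] turns the column sums of the product into sums over neighbours. *)
Lemma Aalpha_eigenvalueP (G : sgraph) (lam : R) :
  eigenvalue (Aalpha alpha G) lam <->
  exists2 y : G -> R, exists u, y u != 0 & forall u,
    alpha * (deg u)%:R * y u + (1 - alpha) * \sum_(w | adj u w) y w = lam * y u.
Proof.
have mulE (v : 'rV[R]_#|G|) u : (v *m Aalpha alpha G) 0 (enum_rank u) =
    alpha * (deg u)%:R * v 0 (enum_rank u)
    + (1 - alpha) * \sum_(w | adj u w) v 0 (enum_rank w).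
  rewrite /Aalpha mulmxDr -!scalemxAr !mxE; congr (_ + _ * _).
    rewrite (bigD1 (enum_rank u)) //= big1 ?addr0 => [|i ni]; last first.
      by rewrite !mxE (negPf ni) mulr0n mulr0.
    by rewrite /degree_mx !mxE eqxx mulr1n enum_rankK -mulrA [v _ _ * _]mulrC.
  rewrite (reindex (@enum_rank G)) /=; last exact/onW_bij/enum_rank_bij.
  rewrite [RHS]big_mkcond; apply: eq_bigr => w _.
  by rewrite !mxE !enum_rankK adj_sym; case: ifP => _; rewrite ?mulr1 ?mulr0.
split=> [/eigenvalueP[v vM v0]|[y [u yu] ye]].
  exists (fun u => v 0 (enum_rank u)).
    have [i vi] : exists i, v 0 i != 0.
      apply/existsP; apply: contraR v0; rewrite negb_exists => /forallP h.
      by apply/eqP/rowP => i; rewrite mxE; apply/eqP; have := h i; rewrite negbK.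
    by exists (enum_val i); rewrite enum_valK.
  by move=> u; rewrite -mulE vM mxE.
apply/eigenvalueP; exists (\row_i y (enum_val i)).
  apply/rowP => i; rewrite -(enum_valK i) mulE !mxE enum_rankK -ye; congr (_ + _ * _).
  by apply: eq_bigr => w _; rewrite mxE enum_rankK.
apply: contra yu => /eqP/rowP/(_ (enum_rank u)); rewrite !mxE enum_rankK.
by move=> ->.
Qed.

(* If y is an eigenvector, compare y with c x at a vertex where |y| / x attains
   its maximum c: equality there propagates along edges to the whole graph. *)
Lemma rho_lt_supersolution (G : sgraph) (x : G -> R) (r : R) :
  alpha < 1 -> connected_graph G -> (forall u, 0 < x u) ->
  (forall u, alpha * (deg u)%:R * x u + (1 - alpha) * \sum_(w | adj u w) x w
     <= r * x u) ->
  (exists u, alpha * (deg u)%:R * x u + (1 - alpha) * \sum_(w | adj u w) x w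
     < r * x u) ->
  rho alpha G < r.
Proof.
move=> a1 [G0 conG] x0 sup [u1 str].
have b0 : 0 < 1 - alpha by rewrite subr_gt0.
have [+ _] := rhoP alpha G0; move/Aalpha_eigenvalueP => [y0 [u0 y0u0] y0E].
set lam := rho alpha G in y0E *.
pose t := [arg max_(u > u0) (`|y0 u| / x u)]%O.
have tmax u : `|y0 u| / x u <= `|y0 t| / x t.
  by rewrite /t; case: arg_maxP => //= i _; exact.
have yt : y0 t != 0.
  apply/eqP => E; have := tmax u0; rewrite E normr0 mul0r leNgt.
  by rewrite divr_gt0 ?normr_gt0.
pose c := `|y0 t| / x t.
(* Sign and scale are chosen so that y <= x everywhere, with equality at t. *)
pose y u := Num.sg (y0 t) * y0 u / c.
have c0 : 0 < c by rewrite divr_gt0 ?normr_gt0.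
have yE u : alpha * (deg u)%:R * y u + (1 - alpha) * \sum_(w | adj u w) y w = lam * y u.
  rewrite /y -big_distrl -big_distrr /=.
  by transitivity (Num.sg (y0 t) * (lam * y0 u) / c); [rewrite -y0E; ring | ring].
have ytE : y t = x t.
  rewrite /y -normrEsg /c; field.
  by rewrite normr_eq0 yt gt_eqF.
have yx u : y u <= x u.
  rewrite /y ler_pdivrMr //; apply: (@le_trans _ _ `|y0 u|).
    by rewrite (le_trans (ler_norm _)) // normrM normr_sg yt mul1r.
  by rewrite -ler_pdivrMl // mulrC; exact: tmax.
(* Where y touches x, lam <= r follows; if lam = r, then y also touches x at every neighbour and the
   supersolution inequality is an equality there. *)
have step u : y u = x u -> lam * x u <= r * x u /\ (lam * x u >= r * x u ->
   (forall w, adj u w -> y w = x w) /\ alpha * (deg u)%:R * x u + (1 - alpha) * \sum_(w | adj u w) x w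
     = r * x u).
  move=> E; have := yE u; rewrite E => yEu.
  have S : \sum_(w | adj u w) y w <= \sum_(w | adj u w) x w by apply: ler_sum.
  have S' : (1 - alpha) * \sum_(w | adj u w) y w <= (1 - alpha) * \sum_(w | adj u w) x w.
    by rewrite ler_pM2l.
  have supu := sup u; split; first by rewrite -yEu; apply: le_trans supu; rewrite lerD2l.
  move=> le; have SE : (1 - alpha) * \sum_(w | adj u w) y w = (1 - alpha) * \sum_(w | adj u w) x w.
    by apply/eqP; rewrite eq_le S' /= -(lerD2l (alpha * (deg u)%:R * x u)) yEu (le_trans supu).
  split; last by apply/eqP; rewrite eq_le supu -SE yEu.
  move/(mulfI (lt0r_neq0 b0)): SE => SE w uw; apply/eqP; rewrite eq_sym -subr_eq0.
  have /eqP := SE; rewrite eq_sym -subr_eq0 -sumrB psumr_eq0; last first.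
    by move=> i _; rewrite subr_ge0.
  by move=> /allP/(_ w (mem_index_enum w)); rewrite uw.
have [+ _] := step t ytE; rewrite ler_pM2r // => lr.
rewrite lt_neqAle lr andbT; apply/eqP => lamr.
have all_eq u : y u = x u.
  have /connectP[p] := conG t u.
  elim/last_ind: p u => [|p z IH] u /=; first by move=> _ ->.
  rewrite rcons_path last_rcons => /andP[pth az] ->.
  have /step[_] := IH _ pth erefl; rewrite lamr => /(_ (lexx _))[+ _]; exact.
have /step[_] := all_eq u1; rewrite lamr => /(_ (lexx _))[_ E].
by rewrite E ltxx in str.
Qed.
End Spectral.

(** * Pendant path sequences *)

Section Tangent.
Variables (R : realFieldType) (f : nat -> R).
Hypothesis f_concave : forall m, f m.+2 - f m.+1 < f m.+1 - f m.

Lemma concave_increment_lt i j : (i < j)%N -> f j.+1 - f j < f i.+1 - f i.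
Proof.
elim: j => // j IH; rewrite ltnS leq_eqVlt => /predU1P[->|/IH]; first exact: f_concave.
exact: lt_trans (f_concave j).
Qed.

(** Induction moves away from the chord through q and q + 1: on l to its right and, with l fixed, on
    q to its left. *)
Lemma concave_tangent_lt q l : l != q -> l != q.+1 ->
  f l < f q + (l%:R - q%:R) * (f q.+1 - f q).
Proof.
move=> lq lq1; case: (ltnP q l) => [ql|]; last rewrite leq_eqVlt (negPf lq) /= => {lq1} lq1.
- have : (q.+1 < l)%N by rewrite ltn_neqAle eq_sym lq1.
  elim: l {lq lq1 ql} => // l IH; rewrite ltnS leq_eqVlt => /predU1P[<-|ql].
    by have := f_concave q; rewrite -(natr1 q.+1) -(natr1 q); lra.
  have := IH ql; have := concave_increment_lt (ltnW ql); rewrite -(natr1 l).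
  lra.
- elim: q lq1 {lq} => // q IH; rewrite ltnS leq_eqVlt => /predU1P[->|lq].
    by have := f_concave q; rewrite -(natr1 q); lra.
  have := IH lq; have c := f_concave q.
  (* The chords starting at q and at q + 1 meet at q + 1, so their gap at l is the drop in slope
     times q - l + 1 > 0. *)
  have : (q%:R - l%:R + 1) * (f q.+2 - f q.+1) < (q%:R - l%:R + 1) * (f q.+1 - f q).
    have lqR : l%:R < q%:R :> R by rewrite ltr_nat.
    by rewrite ltr_pM2l //; lra.
  by rewrite -(natr1 q); lra.
Qed.

Lemma concave_tangent_le q l : f l <= f q + (l%:R - q%:R) * (f q.+1 - f q).
Proof.
have [->|lq] := eqVneq l q; first by lra.
have [->|lq1] := eqVneq l q.+1; first by rewrite -(natr1 q); lra.
exact/ltW/concave_tangent_lt.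
Qed.
End Tangent.

(* Solution of a d(u) x_u + sum_(w ~ u) x_w = (s + 2 a) x_u along a path that
   ends in a pendant vertex: [path_val j] is the value at distance [j] from that
   vertex and [path_ratio j.+1] is [path_val j / path_val j.+1].  The initial value
   [- a] encodes the equation at the pendant vertex itself. *)
Section PathSequences.
Variables (R : realType) (a s : R).

Fixpoint path_ratio (l : nat) : R :=
  if l is m.+1 then (s - path_ratio m)^-1 else - a.

Fixpoint path_val (j : nat) : R :=
  if j is i.+1 then path_val i / path_ratio j else 1.

Hypotheses (a0 : 0 < a) (s2 : 2 <= s).

Lemma path_ratio_lt1 l : path_ratio l < 1.
Proof.
elim: l => [|l IH] /=; first by have := a0; lra.
by rewrite invf_lt1; have := s2; lra.
Qed.

Lemma path_ratio_den l : 1 < s - path_ratio l.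
Proof. by have := path_ratio_lt1 l; have := s2; lra. Qed.

Lemma path_ratio_gt0 l : 0 < path_ratio l.+1.
Proof. by rewrite /= invr_gt0; have := path_ratio_den l; lra. Qed.

Lemma path_ratio_mul l : path_ratio l.+1 * (s - path_ratio l) = 1.
Proof. by have := path_ratio_den l; rewrite /= => h; rewrite mulVf // gt_eqF //; lra. Qed.

(** Consecutive increments have ratio F_(l+2) F_(l+1): its positivity gives monotonicity, and its
    being below 1 gives strict concavity. *)
Lemma path_ratioB l : path_ratio l.+2 - path_ratio l.+1 =
  path_ratio l.+2 * path_ratio l.+1 * (path_ratio l.+1 - path_ratio l).
Proof.
transitivity (path_ratio l.+2 * (path_ratio l.+1 * (s - path_ratio l))
   - path_ratio l.+1 * (path_ratio l.+2 * (s - path_ratio l.+1))); last by ring.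
by rewrite !path_ratio_mul; ring.
Qed.

Lemma path_ratio_lt l : path_ratio l < path_ratio l.+1.
Proof.
elim: l => [|l IH].
  by have := path_ratio_gt0 0; have := a0; rewrite [path_ratio 0]/=; lra.
by rewrite -subr_gt0 path_ratioB !mulr_gt0 ?path_ratio_gt0 ?subr_gt0.
Qed.

Lemma path_ratio1_le l : path_ratio 1 <= path_ratio l.+1.
Proof. by elim: l => // l IH; apply: le_trans IH (ltW (path_ratio_lt _)). Qed.

Lemma path_ratio_concave l : path_ratio l.+3 - path_ratio l.+2 < path_ratio l.+2 - path_ratio l.+1.
Proof.
rewrite path_ratioB -[ltRHS]mul1r ltr_pM2r ?subr_gt0 ?path_ratio_lt //.
by rewrite mulr_ilt1 ?path_ratio_lt1 ?ltW ?path_ratio_gt0.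
Qed.

Lemma path_val_gt0 j : 0 < path_val j.
Proof. by elim: j => //= j IH; rewrite divr_gt0 // (path_ratio_gt0 j). Qed.

Lemma path_val_ratio j : path_val j = path_ratio j.+1 * path_val j.+1.
Proof.
by rewrite [path_val j.+1]/= mulrC divfK // gt_eqF // (path_ratio_gt0 j).
Qed.

Lemma path_val1 : path_val 1 = s + a.
Proof. by rewrite /= div1r invrK opprK. Qed.

Lemma path_val_rec j : path_val j + path_val j.+2 = s * path_val j.+1.
Proof.
have -> : path_val j.+2 = (s - path_ratio j.+1) * path_val j.+1.
  by rewrite [path_val j.+1]path_val_ratio mulrA [_ * path_ratio _]mulrC path_ratio_mul mul1r.
by rewrite path_val_ratio; ring.
Qed.
End PathSequences.

(** * Solving the equation at the center *)

Section Root.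
Variables (R : realType) (a : R) (k : nat) (l : 'I_k -> nat).
Hypotheses (a1 : 1 <= a) (l1 : forall i, (0 < l i)%N).

Lemma continuous_path_ratio m (s : R) : 2 <= s ->
  {for s, continuous (fun t => path_ratio a t m)}.
Proof.
move=> s2; elim: m => [|m IH] /=; first exact: cvg_cst.
apply: (@continuousV _ _ (fun t => t - path_ratio a t m)).
  by rewrite gt_eqF //; have := path_ratio_den (lt_le_trans ltr01 a1) s2 m; lra.
by apply: continuousB => //; exact: cvg_id.
Qed.

Let g (s : R) := s + 2 * a - a * (k + 6)%:R - 6 * (s - 1)^-1
  - \sum_(i < k) path_ratio a s (l i).

Let continuous_g (s : R) : 2 <= s -> {for s, continuous g}.
Proof.
move=> s2; apply: continuousB; last first.
  rewrite /continuous_at; apply: cvg_big => [|i _]; first exact: add_continuous.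
  exact: continuous_path_ratio.
apply: continuousB.
  apply: continuousB; last exact: cvg_cst.
  by apply: continuousD; [exact: cvg_id | exact: cvg_cst].
apply: continuousM; first exact: cvg_cst.
apply: (@continuousV R R (fun t : R => t - 1) s); first by rewrite gt_eqF //; lra.
by apply: continuousB; [exact: cvg_id | exact: cvg_cst].
Qed.

(* The unknown [s] is [r - 2 a]. *)
Lemma center_equation_root : exists2 s : R, a * (k + 6)%:R + a^-1 <= s + 2 * a &
  s + 2 * a = a * (k + 6)%:R + 6 * (s - 1)^-1 + \sum_(i < k) path_ratio a s (l i).
Proof.
have a1' := a1; have a0 : 0 < a by lra.
have ia0 : 0 < a^-1 by rewrite invr_gt0.
have aia : a * a^-1 = 1 by rewrite mulfV // gt_eqF.
have ia1 : a^-1 <= 1 by rewrite invf_le1.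
have k0 : 0 <= k%:R :> R by [].
have ak : 0 <= a * k%:R by rewrite mulr_ge0 // ltW.
(* These are the points where s + 2 a equals a (k + 6) + 1 / a and (a + 1) (k + 6), respectively. *)
pose s0 := a * (k%:R + 4) + a^-1; pose s1 := (a + 1) * (k%:R + 6) - 2 * a.
have s02 : 2 <= s0 by rewrite /s0; lra.
have s01 : s0 <= s1 by rewrite /s0 /s1; lra.
have kE : (k + 6)%:R = k%:R + 6 :> R by rewrite natrD.
(* Each of the k + 6 fractions is at least 1 / (a (k + 6)), since s0 + a <= a (k + 6) and path
   ratios increase from F_1; together they reach 1 / a. *)
have g0 : g s0 <= 0.
  have F1 : (a * (k%:R + 6))^-1 <= path_ratio a s0 1.
    by rewrite /= lef_pV2 ?posrE /s0 ?mulr_gt0 //; lra.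
  have F2 : (a * (k%:R + 6))^-1 <= (s0 - 1)^-1.
    by rewrite /= lef_pV2 ?posrE /s0 ?mulr_gt0 //; lra.
  have S : \sum_(i < k) (a * (k%:R + 6))^-1 <= \sum_(i < k) path_ratio a s0 (l i).
    apply: ler_sum => i _; apply: le_trans F1 _.
    by case: (l i) (l1 i) => // m _; apply: path_ratio1_le.
  have E : (a * (k%:R + 6))^-1 * (k%:R + 6) = a^-1.
    by field; rewrite !gt_eqF //; lra.
  move: S; rewrite sumr_const card_ord -[_ *+ k]mulr_natr => S.
  by rewrite /g kE {1}/s0; lra.
(* Here each of the k + 6 fractions is at most 1. *)
have g1 : 0 <= g s1.
  have F2 : (s1 - 1)^-1 <= 1 by rewrite invf_le1 /s1; lra.
  have S : \sum_(i < k) path_ratio a s1 (l i) <= \sum_(i < k) 1.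
    by apply: ler_sum => i _; apply/ltW/path_ratio_lt1 => //; lra.
  move: S; rewrite sumr_const card_ord => S.
  by rewrite /g kE {1}/s1; lra.
have [||s] := @IVT R g s0 s1 0 s01.
- apply: continuous_in_subspaceT => s; rewrite inE /= in_itv /= => /andP[s0s _].
  by apply: continuous_g; apply: le_trans s0s.
- by rewrite ge_min g0 le_max g1 orbT.
rewrite in_itv /= => /andP[s0s _] gs; exists s; first by rewrite kE; move: s0s; rewrite /s0; lra.
by move: gs; rewrite /g; lra.
Qed.
End Root.

(** * The graph T3 *)

Section T3.
Variables (k : nat) (l : 'I_k -> nat).
Local Notation T := (T3 l).

Definition center : T := inl None.
Definition corner (p : 'I_3 * bool) : T := inl (Some p).
Definition path_pt (i : 'I_k) (j : 'I_(l i)) : T := inr (Tagged (fun i => 'I_(l i)) j).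

Lemma T3_ind (P : T -> Prop) : P center -> (forall p, P (corner p)) ->
  (forall i (j : 'I_(l i)), P (path_pt j)) -> forall u, P u.
Proof. by move=> h1 h2 h3 [[p|]|[i j]]; [exact: h2 | exact: h1 | exact: h3]. Qed.

Section BigT3.
Variables (M : Type) (idx : M) (op : Monoid.com_law idx).

Lemma big_option (A : finType) (P : pred (option A)) (F : option A -> M) :
  \big[op/idx]_(x | P x) F x =
  op (if P None then F None else idx) (\big[op/idx]_(x | P (Some x)) F (Some x)).
Proof.
rewrite big_mkcond (bigD1 None) //=; congr (op _ _).
rewrite [RHS]big_mkcond /= (reindex_omap Some id) /=; last by case.
by apply: eq_big => // x; rewrite eqxx.
Qed.

Lemma big_T3 (P : pred T) (F : T -> M) :
  \big[op/idx]_(u | P u) F u =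
  op (op (if P center then F center else idx) (\big[op/idx]_(p | P (corner p)) F (corner p)))
     (\big[op/idx]_i \big[op/idx]_(j : 'I_(l i) | P (path_pt j)) F (path_pt j)).
Proof.
rewrite big_sumType big_option /= sig_big_dep /=; congr (op _ _).
by apply: eq_big => [[i j]|[i j] _] //=; rewrite andbT.
Qed.

Hypothesis l_gt0 : forall i, (0 < l i)%N.

(** Neighbourhood sums are computed in an arbitrary commutative monoid, to serve both for degrees in
    [nat] and for the eigenvector equation in [R]. *)
Lemma big_adj_center (F : T -> M) :
  \big[op/idx]_(w | adj center w) F w =
  op (\big[op/idx]_p F (corner p)) (\big[op/idx]_i F (path_pt (Ordinal (l_gt0 i)))).
Proof.
rewrite big_T3 /= Monoid.mul1m; congr (op _ _); apply: eq_bigr => i _.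
by rewrite (big_pred1 (Ordinal (l_gt0 i))) // => j; rewrite -val_eqE.
Qed.

Lemma big_adj_corner (i : 'I_3) (b : bool) (F : T -> M) :
  \big[op/idx]_(w | adj (corner (i, b)) w) F w = op (F center) (F (corner (i, ~~ b))).
Proof.
rewrite big_T3 /= [X in op _ X]big1 ?Monoid.mulm1 => [|i' _]; last by rewrite big_pred0.
congr (op _ _); rewrite (big_pred1 (i, ~~ b)) // => -[i' b'] /=.
by rewrite xpair_eqE eq_sym; case: b b' => [] [].
Qed.

(* Counted from the center; meaningful for [m <= l i]. *)
Definition path_pos (i : 'I_k) (m : nat) : T :=
  if m is m'.+1 then if insub m' is Some j then path_pt (i := i) j else center else center.

Arguments path_pos : simpl never.

Lemma path_posE i (j : 'I_(l i)) : path_pos i j.+1 = path_pt j.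
Proof. by rewrite /path_pos /= valK. Qed.

Lemma path_pos_Ordinal i m (ml : (m < l i)%N) : path_pos i m.+1 = path_pt (Ordinal ml).
Proof. by rewrite -path_posE. Qed.

Lemma big_adj_path_pos i m (F : T -> M) : (m < l i)%N ->
  \big[op/idx]_(w | adj (path_pos i m.+1) w) F w =
  op (F (path_pos i m)) (if (m.+1 < l i)%N then F (path_pos i m.+2) else idx).
Proof.
move=> ml; rewrite {1}path_pos_Ordinal; pose j := Ordinal ml.
rewrite big_T3 /= [X in op (op _ X) _]big_pred0 ?Monoid.mulm1 //.
rewrite (bigD1 i) //= [X in op _ (op _ X)]big1 ?Monoid.mulm1 => [|i' ni]; last first.
  by rewrite big_pred0 // => j'; rewrite eq_sym (negPf ni).
rewrite eqxx /=.
have split_ (A : pred 'I_(l i)) (B : pred 'I_(l i)) G : (forall x, A x -> ~~ B x) ->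
  \big[op/idx]_(x | A x || B x) G x = op (\big[op/idx]_(x | A x) G x) (\big[op/idx]_(x | B x) G x).
  by move=> AB; rewrite bigU //=; apply/pred0P => x /=; apply/negbTE/andP => -[/AB/negP].
rewrite split_; last by move=> x /eqP <-; lia.
rewrite [X in op _ (op X _)](_ : _ = if (m.+1 < l i)%N then F (path_pos i m.+2) else idx); last first.
  case: ifP => [m1|m1]; last by rewrite big_pred0 // => x; apply/eqP => E; have := ltn_ord x; rewrite -E m1.
  by rewrite (big_pred1 (Ordinal m1)) ?path_pos_Ordinal // => x; rewrite -val_eqE /= eq_sym.
rewrite Monoid.mulmC -Monoid.mulmA Monoid.mulmC; congr (op _ _).
(* For m = 0 the inner neighbour is the center and the path contributes nothing; otherwise it is the
   preceding path vertex. *)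
rewrite {}/j {split_}; case: m ml => [|m] ml /=; first by rewrite big_pred0 ?Monoid.mul1m // => x; rewrite eqn0Ngt.
have ml' : (m < l i)%N by apply: ltnW.
rewrite (big_pred1 (Ordinal ml')) => [|x]; last by rewrite /= -val_eqE.
by rewrite Monoid.mulm1 path_pos_Ordinal.
Qed.
End BigT3.

Lemma card_T3 : #|T| = (7 + \sum_i l i)%N.
Proof.
rewrite -sum1_card (big_T3 _ xpredT) /= sum_nat_const card_prod card_ord card_bool.
by rewrite addnC muln1 addnC; congr addn; apply: eq_bigr => i _; rewrite sum1_card card_ord.
Qed.

Hypothesis l_gt0 : forall i, (0 < l i)%N.

Lemma deg_center : deg center = (k + 6)%N.
Proof.
rewrite degE (big_adj_center _ l_gt0) !sum_nat_const card_prod !card_ord card_bool.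
by rewrite !muln1 addnC.
Qed.

Lemma deg_corner p : deg (corner p) = 2%N.
Proof. by case: p => i b; rewrite degE big_adj_corner. Qed.

Lemma deg_path_pt i (j : 'I_(l i)) : deg (path_pt j) = if (j.+1 < l i)%N then 2%N else 1%N.
Proof. by rewrite -path_posE degE big_adj_path_pos //; case: ifP. Qed.

Lemma T3_connected : connected_graph T.
Proof.
split; first by rewrite card_T3.
have C u : connect (@adj T) center u.
  elim/T3_ind: u => [|p|i j]; [exact: connect0 | exact: connect1 |].
  rewrite -path_posE; elim: (val j) (ltn_ord j) => [|m IH] ml.
    by rewrite path_pos_Ordinal connect1.
  rewrite (connect_trans (IH (ltnW ml))) // connect1 //.
  by rewrite (path_pos_Ordinal ml) (path_pos_Ordinal (ltnW ml)) /= !eqxx.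
move=> u w; rewrite (connect_trans (y := center)) // sym_connect_sym //.
exact: adj_sym.
Qed.

Lemma sum_deg_T3 : (\sum_(u : T) deg u = 18 + 2 * \sum_i l i)%N.
Proof.
rewrite (big_T3 _ xpredT) /= deg_center (eq_bigr (fun _ => 2%N)) => [|p _]; last exact: deg_corner.
rewrite sum_nat_const card_prod card_ord card_bool /=.
rewrite (_ : \sum_(i < k) _ = \sum_(i < k) (2 * l i - 1))%N; last first.
  apply: eq_bigr => i _; rewrite (eq_bigr (fun j : 'I_(l i) => if (j.+1 < l i)%N then 2%N else 1%N)).
    case: (l i) (l_gt0 i) => // m _; rewrite big_ord_recr /= ltnn (eq_bigr (fun=> 2%N)).
      by rewrite sum_nat_const card_ord; lia.
    by move=> j _; rewrite /= ltnS ltn_ord.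
  by move=> j _; exact: deg_path_pt.
have : (\sum_(i < k) (2 * l i - 1) + k = 2 * \sum_(i < k) l i)%N.
  transitivity (\sum_(i < k) (2 * l i - 1) + \sum_(i < k) 1)%N.
    by rewrite sum1_card card_ord.
  rewrite -big_split big_distrr; apply: eq_bigr => i _ /=.
  by have := l_gt0 i; lia.
move: (\sum_(i < k) _)%N (\sum_(i < k) l i)%N => S1 S2; lia.
Qed.

Lemma pendants_T3 : #|[set x : T | deg x == 1%N]| = k.
Proof.
rewrite -sum1_card (eq_bigl (fun x : T => deg x == 1%N)) => [|x]; last by rewrite inE.
have dc : (deg center == 1%N) = false by rewrite deg_center; lia.
rewrite (big_T3 _ (fun x : T => deg x == 1%N)) dc big_pred0; last by move=> p; rewrite deg_corner.
rewrite /= add0n; transitivity (\sum_(i < k) 1)%N; last by rewrite sum1_card card_ord.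
apply: eq_bigr => i _.
have lt : ((l i).-1 < l i)%N by rewrite prednK.
rewrite (big_pred1 (Ordinal lt)) // => j; rewrite deg_path_pt /= -val_eqE /=.
by have := l_gt0 i; have := ltn_ord j; case: ifP; lia.
Qed.

Lemma T3_tricyclic_pendant n : (7 <= n)%N -> (\sum_i l i = n - 7)%N -> tricyclic_pendant n k T.
Proof.
move=> n7 sl; split; last exact: pendants_T3.
split; [by rewrite card_T3 sl subnKC | exact: T3_connected |].
by have := sum_deg_T3; rewrite sum_deg sl; lia.
Qed.

Section Eigenvector.
Variables (R : realType) (a s : R).
Hypotheses (a0 : 0 < a) (s2 : 2 <= s).

(** Normalized to 1 at the center. Since [path_val] counts from the pendant end, a path vertex at
    distance m from the center has index l_i - m. The value x = 1 / (s - 1) solves the corner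
    equation s x = 1 + x. *)
Definition T3_vec (u : T) : R :=
  match u with
  | inl None => 1
  | inl (Some _) => (s - 1)^-1
  | inr q => path_val a s (l (tag q) - (tagged q).+1) / path_val a s (l (tag q))
  end.

Lemma T3_vec_path_pos i m : (m <= l i)%N ->
  T3_vec (path_pos i m) = path_val a s (l i - m) / path_val a s (l i).
Proof.
case: m => [_|m ml]; last by rewrite path_pos_Ordinal.
by rewrite subn0 divff // gt_eqF // path_val_gt0.
Qed.

Lemma T3_vecP u :
  s + 2 * a = a * (k + 6)%:R + 6 * (s - 1)^-1 + \sum_(i < k) path_ratio a s (l i) ->
  a * (deg u)%:R * T3_vec u + \sum_(w | adj u w) T3_vec w = (s + 2 * a) * T3_vec u.
Proof.
move=> E; have s2' := s2; have s1 : s - 1 != 0 by rewrite gt_eqF //; lra.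
elim/T3_ind: u => [|[i b]|i j].
- rewrite deg_center (big_adj_center _ l_gt0) /= !mulr1 E addrA; congr (_ + _ + _).
    by rewrite sumr_const card_prod card_ord card_bool mulr_natl.
  apply: eq_bigr => i _; rewrite /= subn1; case: (l i) (l_gt0 i) => // m _.
  by rewrite succnK [path_val _ _ m]path_val_ratio // mulfK // gt_eqF // path_val_gt0.
- by rewrite deg_corner big_adj_corner /=; field.
- rewrite -path_posE big_adj_path_pos // path_posE deg_path_pt -path_posE.
  have lj := ltn_ord j; rewrite (T3_vec_path_pos lj) (T3_vec_path_pos (ltnW lj)).
  have : path_val a s (l i) != 0 by rewrite gt_eqF // path_val_gt0.
  move: (val j) lj => m ml nz.
  have -> : (l i - m = (l i - m.+1).+1)%N by lia.
  (* At the pendant end the equation reads a + (s + a) = s + 2 a, by [path_val1]. *)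
  case: ifP => m1; last first.
    by rewrite (_ : l i - m.+1 = 0)%N ?path_val1 /=; [rewrite Monoid.mulm1; field | lia].
  rewrite T3_vec_path_pos //.
  have -> : (l i - m.+1 = (l i - m.+2).+1)%N by lia.
  have := path_val_rec a0 s2 (l i - m.+2).
  set X := path_val a s _.+2; set Y := path_val a s _.+1; set Z := path_val a s (l i - m.+2).
  move=> h /=; have -> : X = s * Y - Z by rewrite -h; ring.
  by field.
Qed.
End Eigenvector.

(** Multiplying a Deg + A by 1 - alpha gives A_alpha, so [T3_vec] exhibits the left side as an
    eigenvalue. *)
Lemma rho_T3_ge (R : realType) (alpha s : R) : let a := alpha / (1 - alpha) in
  0 < alpha < 1 -> 2 <= s ->
  s + 2 * a = a * (k + 6)%:R + 6 * (s - 1)^-1 + \sum_(i < k) path_ratio a s (l i) ->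
  (1 - alpha) * (s + 2 * a) <= rho alpha T.
Proof.
move=> a /andP[al0 al1] s2 E; have b0 : 1 - alpha != 0 by rewrite gt_eqF ?subr_gt0.
have a0 : 0 < a by rewrite divr_gt0 ?subr_gt0.
have [_] := rhoP alpha (let: conj h _ := T3_connected in h); apply.
apply/Aalpha_eigenvalueP; exists (T3_vec a s); first by exists center; rewrite oner_eq0.
move=> u; rewrite -[RHS]mulrA -(T3_vecP a0 s2 u E).
rewrite mulrDr !mulrA; congr (_ * _ * _ + _); rewrite /a; field.
by [].
Qed.
End T3.

(** * Graphs without a vertex of degree k + 6 *)

Lemma rho_lt_scaled (R : realType) (alpha : R) (G : sgraph) (x : G -> R) (r : R) :
  let a := alpha / (1 - alpha) in
  alpha < 1 -> connected_graph G -> (forall u, 0 < x u) ->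
  (forall u, a * (deg u)%:R * x u + \sum_(w | adj u w) x w <= r * x u) ->
  (exists u, a * (deg u)%:R * x u + \sum_(w | adj u w) x w < r * x u) ->
  rho alpha G < (1 - alpha) * r.
Proof.
move=> a a1 conG x0 sup [u0 str]; have b0 : 0 < 1 - alpha by rewrite subr_gt0.
have E u : alpha * (deg u)%:R * x u + (1 - alpha) * \sum_(w | adj u w) x w =
    (1 - alpha) * (a * (deg u)%:R * x u + \sum_(w | adj u w) x w).
  by rewrite /a; field; rewrite gt_eqF.
apply: (rho_lt_supersolution a1 conG x0) => [u|].
  by rewrite E -[leRHS]mulrA ler_pM2l.
by exists u0; rewrite E -[ltRHS]mulrA ltr_pM2l.
Qed.

Section Excess.
Variables (G : sgraph) (n k : nat).
Hypotheses (Gtp : tricyclic_pendant n k G) (n1 : (1 < n)%N).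

Let conG : connected_graph G. Proof. by case: Gtp => -[]. Qed.

Lemma tricyclic_deg_gt0 u : (0 < deg (u : G))%N.
Proof. by apply: connected_deg_gt0 => //; case: Gtp => -[->]. Qed.

(** Truncated subtraction counts a pendant vertex as 0 instead of -1, so the sum is 2 (n + 2) - 2 n
    + k. *)
Lemma sum_excess : (\sum_(u : G) (deg u - 2) = k + 4)%N.
Proof.
have [[cG _ eG] kG] := Gtp.
have : (\sum_(u : G) (deg u - 2) + \sum_(u : G) 2 = \sum_(u : G) deg u + \sum_(u : G) (deg u == 1%N))%N.
  rewrite -!big_split; apply: eq_bigr => u _ /=.
  by have := tricyclic_deg_gt0 u; case: (deg u) => [|[|m]] //=; lia.
have -> : (\sum_(u : G) (deg u == 1%N) = k)%N.
  by rewrite -kG -sum1dep_card [RHS]big_mkcond; apply: eq_bigr => u _; case: eqP.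
by rewrite sum_deg eG sum_nat_const cG; lia.
Qed.

Lemma sum_excess_but u : (\sum_(w | w != u) (deg (w : G) - 2) = k + 4 - (deg u - 2))%N.
Proof. by have := sum_excess; rewrite (bigD1 u) //= => <-; rewrite addKn. Qed.

Lemma deg_le u : (deg (u : G) <= k + 6)%N.
Proof.
have := sum_excess; rewrite (bigD1 u) //=.
by move: (\sum_(i | _) _)%N => S; lia.
Qed.

Lemma exists_pendant : (0 < k)%N -> exists p : G, deg p = 1%N.
Proof.
have [_ <-] := Gtp; case/card_gt0P => p; rewrite inE => /eqP; by exists p.
Qed.

Section LowDegree.
Hypotheses (k0 : (0 < k)%N) (low : forall u : G, deg u != (k + 6)%N).

Let deg_le5 u : (deg (u : G) <= k + 5)%N.
Proof. by have := deg_le u; have := low u; lia. Qed.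

(* At a vertex of degree [k + 5] the plain degree is not a supersolution when
   [alpha] is close to 1/2; hence the correction. *)
Definition deg_weight (u : G) : nat := (2 * deg u + (deg u == k + 5))%N.

(** Two vertices of degree k + 5 would have excess 2 (k + 3), more than the total k + 4. *)
Lemma card_second_degree u :
  (\sum_(w | w != u) (deg (w : G) == k + 5) <= (deg u != k + 5))%N.
Proof.
have : ((k + 3) * \sum_(w : G) (deg w == k + 5) <= \sum_(w : G) (deg w - 2))%N.
  by rewrite big_distrr; apply: leq_sum => w _ /=; case: eqP => [->|]; lia.
rewrite sum_excess (bigD1 u) //=; move: (\sum_(i | _) _)%N => S; nia.
Qed.

(** Up to the correction, a neighbour weighs at most 4 plus twice its excess. Summing the excess
    over all vertices other than u, of degree d, gives 4 d + 2 (k + 6 - d). *)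
Lemma sum_deg_weight_le u : (1 < deg u)%N ->
  (\sum_(w | adj u w) deg_weight w <= 2 * deg u + 2 * (k + 6) + (deg u != k + 5))%N.
Proof.
move=> d1; have dk := deg_le u.
have : (\sum_(w | adj u w) deg_weight w <=
  \sum_(w | adj u w) 4 + \sum_(w | w != u) (2 * (deg w - 2) + (deg w == k + 5)))%N.
  apply: (@leq_trans (\sum_(w | adj u w) (4 + (2 * (deg w - 2) + (deg w == k + 5)))))%N.
    apply: leq_sum => w _; rewrite /deg_weight addnA leq_add2r.
    by have := tricyclic_deg_gt0 w; lia.
  rewrite big_split leq_add2l /= [leqRHS](bigID (adj u)) /=.
  rewrite (eq_bigl (fun w => (w != u) && adj u w)) ?leq_addr // => w.
  by case: eqP => [->|]; rewrite ?adj_irr.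
rewrite [X in (_ + X)%N]big_split -big_distrr /= sum_excess_but; have := card_second_degree u.
rewrite sum_nat_const -[#|_|]/#|[pred w | adj u w]| -cardsE -/(deg u).
by move: (\sum_(i | _) deg_weight _)%N (\sum_(i | _) _)%N => S S' h1 h2; lia.
Qed.

Lemma rho_lt_of_low_degree (R : realType) (alpha r : R) : let a := alpha / (1 - alpha) in
  2^-1 <= alpha < 1 -> a * (k + 6)%:R + a^-1 <= r -> rho alpha G < (1 - alpha) * r.
Proof.
move=> a /andP[al al1] hr.
have a1 : 1 <= a by rewrite ler_pdivlMr ?subr_gt0 //; lra.
have ia1 : a^-1 <= 1 by rewrite invf_le1 //; lra.
have aia : a * a^-1 = 1 by rewrite mulfV // gt_eqF //; lra.
have ia2 : 2 - a <= a^-1.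
  have : 0 <= (a - 1) * (1 - a^-1) by rewrite mulr_ge0 //; lra.
  by lra.
have kR : 1 <= k%:R :> R by rewrite ler1n.
move: hr; rewrite natrD => hr.
have akR : 0 <= (a - 1) * (k%:R - 1) by rewrite mulr_ge0 //; lra.
(* The inequality is strict at a pendant vertex, whose only neighbour weighs at most 2 (k + 5) +
   1. *)
have pend u : deg u = 1%N -> a * (deg u)%:R * (deg_weight u)%:R +
    \sum_(w | adj u w) (deg_weight w)%:R < r * (deg_weight u)%:R.
  move=> du; have : (\sum_(w | adj u w) deg_weight w <= \sum_(w | adj u w) (2 * k + 11))%N.
    by apply: leq_sum => w _; have := deg_le5 w; rewrite /deg_weight; case: eqP; lia.
  rewrite sum_nat_const -[#|_|]/#|[pred w | adj u w]| -cardsE -/(deg u) du mul1n.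
  rewrite -(ler_nat R) natr_sum => S.
  have -> : deg_weight u = 2%N by rewrite /deg_weight du; lia.
  by move: S; rewrite natrD natrM; lra.
apply: (@rho_lt_scaled _ _ _ (fun u => (deg_weight u)%:R)) => //; rewrite -/a.
- by move=> u; rewrite ltr0n /deg_weight; have := tricyclic_deg_gt0 u; lia.
- move=> u; have [d1|d1] := eqVneq (deg u) 1%N; first exact/ltW/pend.
  have {}d1 : (1 < deg u)%N by have := tricyclic_deg_gt0 u; lia.
  have := sum_deg_weight_le d1; rewrite -(ler_nat R) natr_sum /deg_weight.
  have [dk|dk] := eqVneq (deg u) (k + 5)%N; set S := \sum_(w | _) _ => hS.
    (* The weight is 2 k + 11 and the neighbours weigh at most twice that, so a (k + 5) + 2 <= r
       suffices; this is a + 1 / a >= 2. *)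
    move: hS; rewrite addn0 dk !(natrD, natrM) => hS.
    rewrite /= mulr1n.
    have e : 0 <= (r - (a * (k%:R + 6) + a^-1)) * (2 * k%:R + 11) by rewrite mulr_ge0 //; lra.
    have e' : 0 <= (a + a^-1 - 2) * (2 * k%:R + 11) by rewrite mulr_ge0 //; lra.
    by lra.
  have {}dk : (deg u <= k + 4)%N by have := deg_le5 u; lia.
  have d2 : 2 <= (deg u)%:R :> R by rewrite (ler_nat R 2).
  have dm : (deg u)%:R <= k%:R + 4 :> R by rewrite -natrD ler_nat.
  move: hS; rewrite !(natrD, natrM) /= mulr1n mulr0n addr0.
  move: (deg u)%:R d2 dm => d d2 dm hS.
  (* What remains is quadratic in d, with 2 <= d <= k + 4; the products supply its nonlinear terms,
     chiefly (d - 2) (k + 4 - d) >= 0. *)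
  have e1 : 0 <= (r - (a * (k%:R + 6) + a^-1)) * d by rewrite mulr_ge0 //; lra.
  have e2' : 0 <= (d - 2) * (k%:R + 4 - d) by rewrite mulr_ge0 //; lra.
  have e2 : 0 <= a * ((d - 2) * (k%:R + 4 - d)) by apply: mulr_ge0 => //; lra.
  have e3 : 0 <= (1 - a^-1) * (k%:R + 4 - d) by rewrite mulr_ge0 //; lra.
  have e4 : 0 <= (a^-1 - (2 - a)) * (k%:R + 4) by rewrite mulr_ge0 //; lra.
  by lra.
have [p dp] := exists_pendant k0; by exists p; apply: pend.
Qed.
End LowDegree.
End Excess.

(** * Graphs with a vertex of degree k + 6 *)

(** Counting vertices makes f bijective; counting arcs makes it surjective on arcs, so that it also
    reflects adjacency. *)
Lemma isomorphic_of_injective_hom (G H : sgraph) (f : H -> G) :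
  injective f -> (forall x y, adj x y -> adj (f x) (f y)) ->
  (#|G| <= #|H|)%N -> (#|edges G| <= #|edges H|)%N -> isomorphic G H.
Proof.
move=> f_inj f_hom cGH eGH.
have [g fK gK] := inj_card_bij f_inj cGH.
have f2_inj : injective (fun p : H * H => (f p.1, f p.2)).
  by move=> [x y] [x' y'] /= [/f_inj-> /f_inj->].
have E : [set (f p.1, f p.2) | p in [set p : H * H | adj p.1 p.2]] =
    [set p : G * G | adj p.1 p.2].
  apply/eqP; rewrite eqEcard card_imset // !card_arcs !sum_deg leq_mul2l eGH andbT.
  by apply/fintype.subsetP => _ /imsetP[[x y] + ->]; rewrite !inE; exact: f_hom.
exists g => [|x y]; first by exists f.
apply/idP/idP => [/f_hom|xy]; first by rewrite !gK.
have : (x, y) \in [set p : G * G | adj p.1 p.2] by rewrite inE.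
by rewrite -E => /imsetP[[x' y']]; rewrite inE /= => + [-> ->]; rewrite !fK.
Qed.

(** Every element of C has a unique partner in C, so pairs can be removed one by one. With m = 3
    this labels the corners of the triangles. *)
Lemma perfect_matching_enum (T : finType) (e : rel T) (m : nat) (C : {set T}) :
  symmetric e -> irreflexive e -> #|C| = (2 * m)%N ->
  (forall u, u \in C -> exists2 w, w \in C & forall z, z \in C -> e u z = (z == w)) ->
  exists c : 'I_m * bool -> T, [/\ injective c, forall p, c p \in C
    & forall i, e (c (i, false)) (c (i, true))].
Proof.
move=> e_sym e_irr; elim: m C => [|m IH] C.
  have f0 (p : 'I_0 * bool) : T by case: p => -[].
  by exists f0; split=> [[[]]|[[]]|[]].
move=> cC mate; have [u uC] : exists u, u \in C by apply/card_gt0P; rewrite cC; lia.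
have [w wC uw] := mate _ uC.
have euw : e u w by rewrite uw.
have nuw : u != w by apply: contraTneq euw => ->; rewrite e_irr.
have wu z : z \in C -> e w z = (z == u).
  have [w' w'C ww'] := mate _ wC; move=> zC; rewrite ww' //; congr (z == _).
  by apply/esym/eqP; rewrite -ww' // e_sym.
have [||c [c_inj cC' ce]] := IH (C :\ u :\ w).
- have := cardsD1 u C; have := cardsD1 w (C :\ u); rewrite uC !inE wC eq_sym nuw /= cC; lia.
- move=> x; rewrite !inE => /and3P[xw xu xC]; have [x' x'C xx'] := mate _ xC.
  exists x' => [|z]; last by rewrite !inE => /and3P[_ _ zC]; exact: xx'.
  have exx' : e x x' by rewrite xx'.
  rewrite !inE x'C andbT; apply/andP; split; apply: contraNneq xu => E.
  - by rewrite -wu // e_sym -E.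
  - by move: exx'; rewrite E e_sym uw // => xE; rewrite xE in xw.
have cCE p : [/\ c p \in C, c p != u & c p != w].
  by have := cC' p; rewrite !inE => /and3P[].
(* The removed pair gets the last index. *)
exists (fun p => if unlift ord_max p.1 is Some j then c (j, p.2) else if p.2 then w else u).
split=> [[i b] [i' b']||i] /=.
- case: unliftP => [j|] ->; case: unliftP => [j'|] ->.
  + by move=> /c_inj [-> ->].
  + by move=> E; have [_ h1 h2] := cCE (j, b); move: h1 h2; rewrite E; case: b' E => _; rewrite eqxx.
  + by move=> E; have [_ h1 h2] := cCE (j', b'); move: h1 h2; rewrite -E; case: b E => _; rewrite eqxx.
  + by case: b b' => [] [] // E; rewrite E eqxx in nuw.
- by move=> [i b] /=; case: unliftP => [j _|_]; [case: (cCE (j, b)) | case: b].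
- by case: unliftP => [j _|_] /=.
Qed.

(** * Decomposition into the vertex v, trails and a core *)

Section HighDegree.
Variables (G : sgraph) (n k : nat) (v : G).
Hypotheses (Gtp : tricyclic_pendant n k G) (n1 : (1 < n)%N).
Hypothesis deg_v : deg v = (k + 6)%N.

(** The vertex [v] alone uses up the total excess k + 4. *)
Lemma deg_le2 u : u != v -> (deg u <= 2)%N.
Proof.
move=> uv; have := sum_excess Gtp n1; rewrite (bigD1 v) //= deg_v => h.
have : (\sum_(w | w != v) (deg w - 2) == 0)%N by move: h; move: (\sum_(w | _) _)%N => S; lia.
by rewrite sum_nat_eq0 => /forall_inP/(_ _ uv); rewrite subn_eq0.
Qed.

Lemma exists_uniq_path p : exists s : seq G,
  [&& path (@adj G) p s, last p s == v & uniq (p :: s)].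
Proof.
have [[_ [_ conG] _] _] := Gtp; have /connectP[s sp sl] := conG p v.
by move: sl; case: (shortenP sp) => s' ? ? _ ->; exists s'; apply/and3P; split.
Qed.

(** Any simple path to [v] will do: the absence of repetitions makes [pos] injective along it. *)
Definition walk p : seq G := xchoose (exists_uniq_path p).

Lemma pendant_card : #|[set x : G | deg x == 1%N]| = k. Proof. by case: Gtp. Qed.

Definition pendant (i : 'I_k) : G := enum_val (cast_ord (esym pendant_card) i).

Definition len (i : 'I_k) : nat := size (walk (pendant i)).

(* Since [walk] ends at [v], the default value makes [pos i (len i) = v]. *)
Definition pos (i : 'I_k) (j : nat) : G := nth v (pendant i :: walk (pendant i)) j.

Lemma deg_pendant i : deg (pendant i) = 1%N.
Proof. by have := enum_valP (cast_ord (esym pendant_card) i); rewrite inE => /eqP. Qed.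

Lemma pendant_inj : injective pendant.
Proof. by move=> i j /enum_val_inj/cast_ord_inj. Qed.

Lemma pendantP u : deg u = 1%N -> exists i, u = pendant i.
Proof.
move=> du; have uP : u \in [set x : G | deg x == 1%N] by rewrite inE du.
exists (cast_ord pendant_card (enum_rank_in uP u)).
by rewrite /pendant cast_ordK enum_rankK_in.
Qed.

Let walkP i : [/\ path (@adj G) (pendant i) (walk (pendant i)),
  last (pendant i) (walk (pendant i)) = v & uniq (pendant i :: walk (pendant i))].
Proof. by have /and3P[? /eqP ? ?] := xchooseP (exists_uniq_path (pendant i)). Qed.

Lemma pos0 i : pos i 0 = pendant i. Proof. by []. Qed.

Lemma pos_len i : pos i (len i) = v.
Proof. by have [_ <- _] := walkP i; rewrite /pos /len (last_nth v). Qed.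

Lemma pos_inj i j j' : (j <= len i)%N -> (j' <= len i)%N -> pos i j = pos i j' -> j = j'.
Proof.
have [_ _ u] := walkP i => jl jl' /eqP.
by rewrite /pos nth_uniq //= => /eqP.
Qed.

Lemma adj_pos i j : (j < len i)%N -> adj (pos i j) (pos i j.+1).
Proof. by have [/(pathP v) h _ _] := walkP i => jl; apply: h. Qed.

Lemma pos_neq i j : (j < len i)%N -> pos i j != v.
Proof.
move=> jl; apply/eqP; rewrite -(pos_len i) => /pos_inj => /(_ (ltnW jl) (leqnn _)) E.
by rewrite E ltnn in jl.
Qed.

Lemma len_gt0 i : (0 < len i)%N.
Proof.
rewrite lt0n; apply/eqP => l0; have := pos_len i; rewrite l0 pos0 => E.
by have := deg_v; rewrite -E deg_pendant; lia.
Qed.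

(** The listed vertices are neighbours, and the degree, 1 at the pendant end and at most 2
    elsewhere, leaves no room for others. *)
Lemma adj_posE i j w : (j < len i)%N ->
  adj (pos i j) w = ((0 < j)%N && (w == pos i j.-1)) || (w == pos i j.+1).
Proof.
move=> jl; pose B := (if (0 < j)%N then [set pos i j.-1] else finset.set0) :|: [set pos i j.+1].
suff /eqP/setP/(_ w) : B == [set w | adj (pos i j) w].
  by rewrite !inE => <-; case: ifP; rewrite !inE.
rewrite eqEcard; apply/andP; split.
  apply/fintype.subsetP => z; rewrite /B finset.in_setU.
  case/orP => [|/finset.set1P->]; last by rewrite inE adj_pos.
  case: ifP => j0; last by rewrite finset.in_set0.
  rewrite finset.in_set1 => /eqP->.
  by rewrite inE adj_sym -{2}(prednK j0) adj_pos //; lia.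
rewrite -/(deg (pos i j)) /B; case: ifP => j0.
  rewrite cards2 (leq_trans (deg_le2 (pos_neq jl))) // ltnS lt0b.
  by apply/eqP => /pos_inj; lia.
by rewrite (_ : j = 0)%N ?pos0 ?deg_pendant ?finset.set0U ?cards1 //; lia.
Qed.

Lemma deg_pos i j : (j < len i)%N -> deg (pos i j) = if j == 0%N then 1%N else 2%N.
Proof.
move=> jl; case: eqP => [->|/eqP]; first by rewrite pos0 deg_pendant.
rewrite -lt0n => j0; apply/eqP; rewrite eqn_leq deg_le2 ?pos_neq //=.
rewrite (_ : 2 = #|[set pos i j.-1; pos i j.+1]|)%N.
  apply/subset_leq_card/fintype.subsetP => z; rewrite !inE adj_posE // j0.
  by [].
rewrite cards2 (_ : pos i j.-1 != pos i j.+1) //.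
by apply/eqP => /pos_inj; lia.
Qed.

(** A common vertex is traced back along trail i: each predecessor is adjacent to a vertex of trail
    i', hence on that trail too, until the pendant vertex of i is reached. Being of degree 1, it
    must also be the start of i'. *)
Lemma pos_disjoint i i' j j' : (j < len i)%N -> (j' < len i')%N ->
  pos i j = pos i' j' -> i = i'.
Proof.
elim: j j' => [|j IH] j' jl jl' E.
  have := deg_pos jl'; rewrite -E pos0 deg_pendant; case: eqP => // j0 _.
  by apply: pendant_inj; rewrite -!pos0 E j0.
have := adj_pos (ltnW jl); rewrite adj_sym E adj_posE // => /orP[/andP[j0 /eqP h]|/eqP h].
  by apply: (IH _ (ltnW jl) _ h); lia.
apply: (IH _ (ltnW jl) _ h); rewrite ltn_neqAle jl' andbT; apply/eqP => E'.
by have := pos_neq (ltnW jl); rewrite h E' pos_len eqxx.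
Qed.

(** The end [v], at index [len i], is left out to make distinct trails disjoint. *)
Definition trail (i : 'I_k) : {set G} := [set pos i (val j) | j : 'I_(len i)].

Definition core : {set G} := ~: (v |: \bigcup_i trail i).

Lemma trailP i u : reflect (exists2 j, (j < len i)%N & u = pos i j) (u \in trail i).
Proof.
apply: (iffP imsetP) => [[j _ ->]|[j jl ->]]; first by exists j.
by exists (Ordinal jl).
Qed.

Lemma pos_trail i j : (j < len i)%N -> pos i j \in trail i.
Proof. by move=> jl; apply/trailP; exists j. Qed.

Lemma core_neq u : u \in core -> u != v.
Proof. by rewrite !inE; apply: contraNneq => ->; rewrite eqxx. Qed.

Lemma core_trail u i : u \in core -> u \notin trail i.
Proof.
rewrite !inE; apply: contraNN => h; apply/orP; right; apply/bigcupP; by exists i.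
Qed.

Lemma vertex_ind (P : G -> Prop) : P v -> (forall i j, (j < len i)%N -> P (pos i j)) ->
  (forall u, u \in core -> P u) -> forall u, P u.
Proof.
move=> h1 h2 h3 u; have [/h3 //|] := boolP (u \in core).
rewrite !inE negbK => /orP[/eqP-> //|/bigcupP[i _ /trailP[j jl ->]]]; exact: h2.
Qed.

Lemma adj_v_last i : adj v (pos i (len i).-1).
Proof.
have lt : ((len i).-1 < len i)%N by rewrite prednK ?len_gt0.
by have := adj_pos lt; rewrite prednK ?len_gt0 // pos_len adj_sym.
Qed.

Section Big.
Variables (M : Type) (idx : M) (op : Monoid.com_law idx).

Lemma big_vertex (F : G -> M) : \big[op/idx]_u F u =
  op (op (F v) (\big[op/idx]_i \big[op/idx]_(j < len i) F (pos i j)))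
     (\big[op/idx]_(u in core) F u).
Proof.
rewrite (bigID (mem core)) /= Monoid.mulmC; congr (op _ _).
rewrite (eq_bigl (mem (v |: \bigcup_i trail i))) => [|u]; last by rewrite inE negbK.
rewrite big_setU1 /=; last first.
  by apply/bigcupP => -[i _ /trailP[j /pos_neq/[swap] <-]]; rewrite eqxx.
congr (op _ _); rewrite partition_disjoint_bigcup => [|i i' ii'].
  apply: eq_bigr => i _; rewrite big_imset => [|j j' _ _ /pos_inj E].
    by apply: eq_bigl => j; rewrite inE.
  by apply/val_inj/E; apply/ltnW/ltn_ord.
rewrite disjoint_subset; apply/fintype.subsetP => u /trailP[j jl ->].
rewrite inE; apply/negP => /trailP[j' jl' /pos_disjoint E].
by move/eqP: ii'; apply; apply: E.
Qed.

Lemma big_adj_v (F : G -> M) : \big[op/idx]_(w | adj v w) F w =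
  op (\big[op/idx]_i F (pos i (len i).-1)) (\big[op/idx]_(w in core | adj v w) F w).
Proof.
rewrite big_mkcond big_vertex adj_irr Monoid.mul1m -big_mkcondr; congr (op _ _).
apply: eq_bigr => i _; have lt : ((len i).-1 < len i)%N by rewrite prednK ?len_gt0.
rewrite (bigD1 (Ordinal lt)) //= adj_v_last.
rewrite big1 ?Monoid.mulm1 // => j; rewrite -val_eqE /= => jl.
rewrite adj_sym adj_posE //; case: ifP => // /orP[/andP[j0 /eqP]|/eqP].
  by rewrite -(pos_len i) => /pos_inj; have := ltn_ord j; lia.
by rewrite -(pos_len i) => /pos_inj; have := ltn_ord j; lia.
Qed.

Lemma big_adj_pos i j (F : G -> M) : (j < len i)%N -> \big[op/idx]_(w | adj (pos i j) w) F w =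
  op (if (0 < j)%N then F (pos i j.-1) else idx) (F (pos i j.+1)).
Proof.
move=> jl; rewrite (eq_bigl _ _ (fun w => adj_posE w jl)); case: ifP => j0 /=.
  rewrite (bigD1 (pos i j.-1)) ?eqxx //=; congr (op _ _); rewrite (big_pred1 (pos i j.+1)) // => w /=.
  case: (w =P pos i j.-1) => [->|] /=; last by rewrite andbT.
  by apply/esym/eqP => /pos_inj; lia.
by rewrite (big_pred1 (pos i j.+1)) // Monoid.mul1m.
Qed.
End Big.

Lemma card_core : (#|core| + \sum_i len i + 1 = n)%N.
Proof.
have [[<- _ _] _] := Gtp; rewrite -[#|G|]sum1_card big_vertex /= ?sum1_card.
rewrite [X in (1 + X + _)%N](eq_bigr (fun i => len i)) => [|i _]; last by rewrite sum_nat_const card_ord muln1.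
by rewrite addnC addnA addnAC.
Qed.

(** Each of the k trails accounts for exactly one of the k + 6 neighbours of [v]. *)
Lemma card_core_adj : #|[set w in core | adj v w]| = 6%N.
Proof.
have := deg_v; rewrite degE big_adj_v /= sum1_card card_ord.
by rewrite -sum1dep_card; move: (\sum_(w | _) _)%N => S; lia.
Qed.

(** A core vertex of degree 1 would be the start of a trail. *)
Lemma deg_core u : u \in core -> deg u = 2%N.
Proof.
move=> uc; have := deg_le2 (core_neq uc).
have := tricyclic_deg_gt0 Gtp n1 u; case E : (deg u) => [|[|[|m]]] //= _ _.
have [i ui] := pendantP E; have := core_trail i uc.
by rewrite ui -pos0 pos_trail ?len_gt0.
Qed.

Lemma adj_core u w : u \in core -> adj u w -> w = v \/ w \in core.
Proof.
move=> uc; elim/vertex_ind: w => [|i j jl|w wc]; [by left| |by right].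
rewrite adj_sym adj_posE // => /orP[/andP[j0 /eqP E]|/eqP E].
  by have := core_trail i uc; rewrite E pos_trail //; lia.
case: (ltnP j.+1 (len i)) => jl'; first by have := core_trail i uc; rewrite E pos_trail.
have jE : j.+1 = len i by lia.
by have := core_neq uc; rewrite E jE pos_len eqxx.
Qed.

(** * The comparison vector on G *)

Section Supersolution.
Variables (R : realType) (a s : R).
Hypotheses (a0 : 0 < a) (s2 : 2 < s).

Let s2' : 2 <= s. Proof. exact: ltW. Qed.

(** This copies the values of [T3_vec], with the core in place of the corners. The index is the
    position counted from the pendant end. *)
Definition super_vec (u : G) : R :=
  if u == v then 1 else
  if [pick i | u \in trail i] is Some i
  then path_val a s (index u (pendant i :: walk (pendant i))) / path_val a s (len i)
  else (s - 1)^-1.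

Lemma super_vec_v : super_vec v = 1. Proof. by rewrite /super_vec eqxx. Qed.

Lemma super_vec_core u : u \in core -> super_vec u = (s - 1)^-1.
Proof.
move=> uc; rewrite /super_vec (negPf (core_neq uc)); case: pickP => // i ui.
by have := core_trail i uc; rewrite ui.
Qed.

Lemma super_vec_pos i j : (j <= len i)%N ->
  super_vec (pos i j) = path_val a s j / path_val a s (len i).
Proof.
rewrite leq_eqVlt => /predU1P[->|jl].
  by rewrite pos_len super_vec_v divff // gt_eqF // path_val_gt0.
rewrite /super_vec (negPf (pos_neq jl)); case: pickP => [i' ii'|/(_ i)]; last by rewrite pos_trail.
have <- : i = i' by case/trailP: ii' => j' jl'; apply: pos_disjoint.
by have [_ _ u] := walkP i; rewrite /pos index_uniq //= ltnS ltnW.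
Qed.

Lemma super_vec_gt0 u : 0 < super_vec u.
Proof.
elim/vertex_ind: u => [|i j jl|u uc]; first by rewrite super_vec_v.
  by rewrite super_vec_pos ?(ltnW jl) // divr_gt0 // path_val_gt0.
by rewrite super_vec_core // invr_gt0; have := s2; lra.
Qed.

Lemma super_vec_path i j : (j < len i)%N ->
  a * (deg (pos i j))%:R * super_vec (pos i j) + \sum_(w | adj (pos i j) w) super_vec w
  = (s + 2 * a) * super_vec (pos i j).
Proof.
move=> jl; rewrite big_adj_pos // deg_pos // (super_vec_pos (ltnW jl)) (super_vec_pos jl).
have : path_val a s (len i) != 0 by rewrite gt_eqF // path_val_gt0.
case: j jl => [|j] jl nz.
  by rewrite path_val1 /= add0r; field.
rewrite ltn0Sn [j.+1.-1]/= super_vec_pos; last by do 2 apply: ltnW.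
have := path_val_rec a0 s2' j.
set X := path_val a s _.+2; set Y := path_val a s _.+1; set Z := path_val a s j.
move=> h /=; have -> : X = s * Y - Z by rewrite -h; ring.
by field.
Qed.

(** Next to [v] the corner equation holds exactly; elsewhere both neighbours have value 1 / (s - 1),
    which leaves a surplus of (s - 2) / (s - 1). *)
Lemma super_vec_core_sum u : u \in core ->
  (s + 2 * a) * super_vec u - (a * (deg u)%:R * super_vec u + \sum_(w | adj u w) super_vec w) =
  (if adj v u then 0 else (s - 2) / (s - 1)).
Proof.
move=> uc; have s1 : s - 1 != 0 by rewrite gt_eqF //; have := s2; lra.
have -> : \sum_(w | adj u w) super_vec w =
    \sum_(w | adj u w) (s - 1)^-1 + \sum_(w | adj u w) (if w == v then 1 - (s - 1)^-1 else 0).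
  rewrite -big_split; apply: eq_bigr => w uw /=.
  have [->|wc] := adj_core uc uw; first by rewrite eqxx super_vec_v addrC subrK.
  by rewrite (negPf (core_neq wc)) addr0 super_vec_core.
have -> : \sum_(w | adj u w) (if w == v then 1 - (s - 1)^-1 else 0) =
    if adj v u then 1 - (s - 1)^-1 else 0.
  rewrite -big_mkcondr; case: ifP => vu.
    by rewrite (big_pred1 v) // => w /=; case: eqP => [->|]; rewrite ?andbF ?andbT // adj_sym.
  by rewrite big_pred0 // => w; case: eqP => [->|]; rewrite ?andbF ?andbT // adj_sym.
rewrite sumr_const -[#|_|]/#|[pred w | adj u w]| -cardsE -/(deg u) deg_core // super_vec_core //.
by case: ifP => _; field.
Qed.

Lemma super_vec_v_sum : a * (deg v)%:R * super_vec v + \sum_(w | adj v w) super_vec w =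
  a * (k + 6)%:R + 6 * (s - 1)^-1 + \sum_i path_ratio a s (len i).
Proof.
rewrite super_vec_v mulr1 deg_v big_adj_v /= -[RHS]addrA; congr (_ + _).
rewrite addrC; congr (_ + _); last first.
  apply: eq_bigr => i _; rewrite super_vec_pos ?leq_pred //.
  case: (len i) (len_gt0 i) => // m _.
  by rewrite succnK [path_val _ _ m]path_val_ratio // mulfK // gt_eqF // path_val_gt0.
rewrite (eq_bigr (fun _ => (s - 1)^-1)) => [|w /andP[wc _]]; last exact: super_vec_core.
by rewrite sumr_const -[#|_|]/#|[pred w | (w \in core) && adj v w]| -cardsE card_core_adj mulr_natl.
Qed.
End Supersolution.

(** All six core vertices are neighbours of [v] and have degree 2, so each has one further
    neighbour, again in the core: they form three triangles with [v]. *)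
Lemma isomorphic_T3 (l : 'I_k -> nat) (sigma : 'I_k -> 'I_k) :
  (forall i, 0 < l i)%N -> injective sigma -> (forall i, l i = len (sigma i)) ->
  #|core| = 6%N -> isomorphic G (T3 l).
Proof.
move=> l0 sigma_inj lE c6.
have coreE : [set w in core | adj v w] = core.
  by apply/eqP; rewrite eqEcard card_core_adj c6 leqnn andbT; apply/fintype.subsetP => w; rewrite inE => /andP[].
have adj_v w : w \in core -> adj v w by rewrite -coreE inE => /andP[].
have [|||u uc|c [c_inj c_core c_adj]] := @perfect_matching_enum G (@adj G) 3 core.
- exact: adj_sym.
- exact: adj_irr.
- exact: c6.
- have : #|[set w | adj u w] :\ v| = 1%N.
    have := cardsD1 v [set w | adj u w]; rewrite -/(deg u) deg_core // inE adj_sym adj_v //; lia.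
  case/eqP/cards1P => w E; have : w \in [set w | adj u w] :\ v by rewrite E inE.
  rewrite !inE => /andP[wv uw]; exists w; first by have [/eqP|] := adj_core uc uw; rewrite ?(negPf wv).
  move=> z zc; move/setP/(_ z): E; rewrite !inE => <-.
  by rewrite (core_neq zc).
(* Attached paths are indexed from the center and trails from the pendant end, so indices are
   reversed; entry j lies at distance j + 1 from the center. *)
pose f (u : T3 l) : G :=
  match u with
  | inl None => v
  | inl (Some p) => c p
  | inr q => pos (sigma (tag q)) (l (tag q) - (tagged q).+1)
  end.
have f_lt i (j : 'I_(l i)) : (l i - j.+1 < len (sigma i))%N by rewrite -lE; have := ltn_ord j; lia.
have c_neq p : c p <> v by apply/eqP/core_neq.
have pos_neq' i (j : 'I_(l i)) : pos (sigma i) (l i - j.+1) <> v by apply/eqP/pos_neq.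
have c_pos p i (j : 'I_(l i)) : pos (sigma i) (l i - j.+1) <> c p.
  by move=> E; have := core_trail (sigma i) (c_core p); rewrite -E pos_trail.
apply: (@isomorphic_of_injective_hom G (T3 l) f).
- move=> u w; elim/(@T3_ind k l): u => [|p|i j]; elim/(@T3_ind k l): w => [|p'|i' j'] //=.
  + by move/esym/c_neq.
  + by move/esym/pos_neq'.
  + by move/c_neq.
  + by move/c_inj->.
  + by move/esym/c_pos.
  + by move/pos_neq'.
  + by move/c_pos.
  + move=> E; have /sigma_inj ii' := pos_disjoint (f_lt i j) (f_lt i' j') E.
    case: _ / ii' j' E => j' /pos_inj E.
    have {}E := E (ltnW (f_lt i j)) (ltnW (f_lt i j')).
    congr (path_pt _); apply: val_inj => /=; have := ltn_ord j; have := ltn_ord j'.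
    by move: E; lia.
- have hom_path i (j j' : 'I_(l i)) : j.+1 = j' :> nat ->
    adj (pos (sigma i) (l i - j'.+1)) (pos (sigma i) (l i - j.+1)).
    move=> jj'; rewrite (_ : l i - j.+1 = (l i - j'.+1).+1)%N ?adj_pos //.
    by have := ltn_ord j'; lia.
  have hom_center i (j : 'I_(l i)) : j = 0%N :> nat -> adj v (pos (sigma i) (l i - j.+1)).
    by move=> ->; rewrite subn1 lE adj_v_last.
  move=> u w; elim/(@T3_ind k l): u => [|p|i j]; elim/(@T3_ind k l): w => [|p'|i' j'] //=.
  + by move=> _; apply: adj_v.
  + by move/eqP; apply: hom_center.
  + by move=> _; rewrite adj_sym adj_v.
  + case: p p' => [i b] [i' b'] /= /andP[/eqP-> bb'].
    by case: b b' bb' => [] [] // _; rewrite // adj_sym.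
  + by move/eqP => j0; rewrite adj_sym; apply: hom_center.
  + case/andP => /eqP ii'; case: _ / ii' j' => j' /orP[]/eqP.
      by move=> h; rewrite adj_sym; apply: hom_path.
    exact: hom_path.
- have := card_core; rewrite card_T3 c6; have [[-> _ _] _] := Gtp.
  rewrite (eq_bigr _ (fun i _ => lE i)) (reindex_inj sigma_inj) /=.
  by move: (\sum_(i < k) _)%N => S; lia.
- have [[_ _ ->] _] := Gtp; have := sum_deg (T3 l); rewrite sum_deg_T3 //.
  rewrite (eq_bigr _ (fun i _ => lE i)); have := card_core; rewrite c6 (reindex_inj sigma_inj) /=.
  by move: (\sum_(i < k) _)%N => S; lia.
Qed.
End HighDegree.

(** * Comparison of path lengths *)

Lemma nearly_equal_two_values (k : nat) (l : 'I_k -> nat) : (0 < k)%N ->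
  (forall i, 1 <= l i)%N -> (forall i j, l i <= l j + 1)%N ->
  exists q, forall i, l i = q.+1 \/ l i = q.+2.
Proof.
case: k l => // k l _ l1 l2.
pose i0 := [arg min_(i < (ord0 : 'I_k.+1)) l i].
exists (l i0).-1 => i; have -> : (l i0).-1.+1 = l i0 by rewrite prednK.
have : (l i0 <= l i)%N by rewrite /i0; case: arg_minnP => // j _; apply.
by have := l2 i i0; lia.
Qed.

(** The number of entries and their sum determine how often each of the two values occurs, so both
    families are the same multiset. *)
Lemma two_values_perm (k : nat) (l l' : 'I_k -> nat) (q : nat) :
  (forall i, l i = q.+1 \/ l i = q.+2) -> (forall i, l' i = q.+1 \/ l' i = q.+2) ->
  (\sum_i l i = \sum_i l' i)%N ->
  exists2 sigma : 'I_k -> 'I_k, injective sigma & forall i, l i = l' (sigma i).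
Proof.
move=> lq l'q sum_eq.
have upE (h : 'I_k -> nat) : (forall i, h i = q.+1 \/ h i = q.+2) ->
    (\sum_i (h i - q.+1) + \sum_(i < k) q.+1 = \sum_i h i)%N.
  by move=> hq; rewrite -big_split; apply: eq_bigr => i _ /=; case: (hq i) => ->; lia.
have downE (h : 'I_k -> nat) : (forall i, h i = q.+1 \/ h i = q.+2) ->
    (\sum_i (q.+2 - h i) + \sum_i h i = \sum_(i < k) q.+2)%N.
  by move=> hq; rewrite -big_split; apply: eq_bigr => i _ /=; case: (hq i) => ->; lia.
have countE (h : 'I_k -> nat) (a : pred nat) : (forall i, h i = q.+1 \/ h i = q.+2) ->
    count a [tuple h i | i < k] =
    (a q.+1 * \sum_i (q.+2 - h i) + a q.+2 * \sum_i (h i - q.+1))%N.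
  move=> hq; rewrite -sum1_count big_mkcond big_map big_enum /= !big_distrr -big_split.
  by apply: eq_bigr => i _ /=; case: (hq i) => ->; case: ifP => _; lia.
have /tuple_permP[p pE] : perm_eq [tuple l i | i < k] [tuple l' i | i < k].
  apply/seq.permP => a; rewrite !countE //.
  congr (_ * _ + _ * _)%N.
    by have := downE _ lq; have := downE _ l'q; rewrite sum_eq; lia.
  by have := upE _ lq; have := upE _ l'q; rewrite sum_eq; lia.
exists p => [|i]; first exact: perm_inj.
have /(congr1 (fun t => tnth t i)) : [tuple l i | i < k] = [tuple tnth [tuple l' i | i < k] (p i) | i < k].
  exact: val_inj.
by rewrite !tnth_mktuple.
Qed.

Section PathRatioSum.
Variables (R : realType) (a s : R) (k q : nat) (l l' : 'I_k -> nat).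
Hypotheses (a0 : 0 < a) (s2 : 2 <= s).
Hypotheses (lq : forall i, l i = q.+1 \/ l i = q.+2) (l'1 : forall i, (0 < l' i)%N).
Hypothesis le_sum : (\sum_i l' i <= \sum_i l i)%N.

Let F m := path_ratio a s m.
(** The chord of [F] through q + 1 and q + 2, hence exact at every [l i]. *)
Let tangent (m : nat) : R := F q.+1 + (m%:R - q.+1%:R) * (F q.+2 - F q.+1).

Let tangent_le m : (0 < m)%N -> F m <= tangent m.
Proof.
(* The chord lemma is applied to the shifted sequence F_(m+1), for which concavity was stated. *)
case: m => // m _; have := concave_tangent_le (path_ratio_concave a0 s2) q m.
by rewrite /tangent -[m.+1%:R]natr1 -[q.+1%:R]natr1; rewrite /F; lra.
Qed.

Let tangent_lt m : (0 < m)%N -> m != q.+1 -> m != q.+2 -> F m < tangent m.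
Proof.
case: m => // m _; rewrite !eqSS => mq mq1.
have := concave_tangent_lt (path_ratio_concave a0 s2) mq mq1.
by rewrite /tangent -[m.+1%:R]natr1 -[q.+1%:R]natr1; rewrite /F; lra.
Qed.

Let sum_l_tangent : \sum_i F (l i) = \sum_i tangent (l i).
Proof.
apply: eq_bigr => i _; rewrite /tangent; case: (lq i) => ->; first by ring.
by rewrite -[q.+2%:R]natr1; ring.
Qed.

Let sum_tangent_sub : \sum_i tangent (l i) - \sum_i tangent (l' i) =
  ((\sum_i l i)%:R - (\sum_i l' i)%:R) * (F q.+2 - F q.+1).
Proof.
rewrite /tangent !natr_sum -!sumrB; move: (F q.+2) (F q.+1) => x y.
by rewrite big_distrl; apply: eq_bigr => i _ /=; ring.
Qed.

(** Each term lies on or below the chord, and the sum of chord values depends only on the total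
    length, increasing with it. *)
Lemma sum_path_ratio_le : \sum_i path_ratio a s (l' i) <= \sum_i path_ratio a s (l i).
Proof.
apply: (@le_trans _ _ (\sum_i tangent (l' i))).
  by apply: ler_sum => i _; apply: tangent_le.
rewrite [leRHS]sum_l_tangent -subr_ge0 sum_tangent_sub mulr_ge0 ?subr_ge0 ?ler_nat //.
exact/ltW/path_ratio_lt.
Qed.

(** Equality case: the positive slope forces equal totals, and any other length would lie strictly
    below the chord. *)
Lemma sum_path_ratio_eq : \sum_i path_ratio a s (l i) <= \sum_i path_ratio a s (l' i) ->
  (\sum_i l' i = \sum_i l i)%N /\ forall i, l' i = q.+1 \/ l' i = q.+2.
Proof.
rewrite [leLHS]sum_l_tangent => le1.
have le2 : \sum_i F (l' i) <= \sum_i tangent (l' i).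
  by apply: ler_sum => i _; apply: tangent_le.
have d0 : 0 < F q.+2 - F q.+1 by rewrite subr_gt0 path_ratio_lt.
have h : (\sum_i l' i = \sum_i l i)%N.
  apply/eqP; rewrite eqn_leq le_sum -(ler_nat R) -subr_le0 -(pmulr_lle0 _ d0) /=.
  by rewrite -sum_tangent_sub subr_le0 (le_trans le1).
split=> // i; have [->|h1] := eqVneq (l' i) q.+1; first by left.
have [->|h2] := eqVneq (l' i) q.+2; first by right.
suff : \sum_i F (l' i) < \sum_i tangent (l' i).
  have := sum_tangent_sub; rewrite h subrr mul0r => /eqP; rewrite subr_eq0 => /eqP <-.
  by move/(le_lt_trans le1); rewrite ltxx.
rewrite (bigD1 i) //= [ltRHS](bigD1 i) //= ltr_leD ?tangent_lt //.
by apply: ler_sum => j _; apply: tangent_le.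
Qed.
End PathRatioSum.

Lemma rho_lt_of_high_degree (R : realType) (alpha s : R) (G : sgraph) (n k : nat)
    (l : 'I_k -> nat) (v : G) : let a := alpha / (1 - alpha) in
  0 < alpha < 1 -> 2 < s -> (7 <= n)%N -> (0 < k)%N ->
  nearly_equal_lengths three_triangles l n ->
  s + 2 * a = a * (k + 6)%:R + 6 * (s - 1)^-1 + \sum_(i < k) path_ratio a s (l i) ->
  tricyclic_pendant n k G -> deg v = (k + 6)%N -> ~ isomorphic G (T3 l) ->
  rho alpha G < (1 - alpha) * (s + 2 * a).
Proof.
move=> a /andP[al0 al1] s2 n7 k0 [l1 l2 sum_l] sE Gtp deg_v nis.
rewrite card_three_triangles in sum_l.
have n1 : (1 < n)%N by lia.
have a0 : 0 < a by rewrite divr_gt0 ?subr_gt0.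
have [q lq] := nearly_equal_two_values k0 l1 l2.
have cc := card_core Gtp n1 deg_v; set C := core v Gtp in cc.
pose L i := len v Gtp i; rewrite -/(\sum_i L i)%N in cc.
have c6 : (6 <= #|C|)%N.
  rewrite -(card_core_adj Gtp n1 deg_v); apply/subset_leq_card/fintype.subsetP => w.
  by rewrite inE => /andP[].
(* The core contains six neighbours of [v], which leaves at most n - 7 vertices for the trails. *)
have le_sum : (\sum_i L i <= \sum_i l i)%N by rewrite sum_l; lia.
have L1 i : (0 < L i)%N by apply: len_gt0.
have le_F := sum_path_ratio_le a0 (ltW s2) lq L1 le_sum.

have atv := super_vec_v_sum Gtp n1 deg_v a0 s2.
apply: (@rho_lt_scaled _ _ _ (super_vec v Gtp a s)) => //; rewrite -/a.
- by have [[_ conG _] _] := Gtp.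
- by move=> u; apply: super_vec_gt0.
- move=> u; elim/(vertex_ind (Gtp := Gtp) (v := v)): u => [|i j jl|u uc].
  + by rewrite atv sE super_vec_v mulr1; lra.
  + by rewrite super_vec_path.
  + rewrite -subr_ge0 super_vec_core_sum //; case: ifP => // _.
    by rewrite divr_ge0 //; lra.
(* Either the inequality at [v] is strict, or the lengths agree up to permutation and six core
   vertices remain, which would make G isomorphic to [T3 l]. *)
have [lt_F|ge_F] := ltP (\sum_i path_ratio a s (L i)) (\sum_i path_ratio a s (l i)).
  by exists v; rewrite atv super_vec_v mulr1 sE ltrD2l.
have [sum_eq Lq] := sum_path_ratio_eq a0 (ltW s2) lq L1 le_sum ge_F.
have [sigma sigma_inj sigmaE] := two_values_perm lq Lq (esym sum_eq).
case: nis; apply: (isomorphic_T3 n1 deg_v l1 sigma_inj sigmaE).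
by rewrite -/C; move: cc; rewrite sum_eq sum_l; lia.
Qed.

Theorem theorem1p1 (R : realType) (alpha : R) (n k : nat) (l : 'I_k -> nat)
    (halpha : 2^-1 <= alpha < 1)
    (hk : (1 <= k <= n - 7)%N)
    (hl : nearly_equal_lengths three_triangles l n) :
  tricyclic_pendant n k (T3 l) /\
  forall G : sgraph, tricyclic_pendant n k G -> ~ isomorphic G (T3 l) ->
    rho alpha G < rho alpha (T3 l).
Proof.
have /andP[al0 al1] := halpha; have /andP[k0 kn] := hk.
have [l1 _] := hl; rewrite card_three_triangles => sum_l.
have n7 : (7 <= n)%N by lia.
have n1 : (1 < n)%N by lia.
split; first exact: T3_tricyclic_pendant.
move=> G Gtp nis; set a := alpha / (1 - alpha).
have a1 : 1 <= a by rewrite ler_pdivlMr ?subr_gt0 //; lra.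
(* The number (1 - alpha) (s + 2 a) separates the two radii: it is at most that of [T3 l] and
   exceeds that of G in both degree cases. *)
have [s s_ge sE] := center_equation_root a1 l1.
have s2 : 2 < s.
  have : 0 < a^-1 by rewrite invr_gt0; lra.
  have : 0 <= (a - 1) * k%:R by rewrite mulr_ge0 //; lra.
  have : 1 <= k%:R :> R by rewrite ler1n.
  by move: s_ge; rewrite natrD; lra.
have al01 : 0 < alpha < 1 by rewrite al1 andbT; lra.
apply: lt_le_trans (rho_T3_ge l1 al01 (ltW s2) sE).
have [/existsP[v /eqP deg_v]|] := boolP [exists v : G, deg v == (k + 6)%N].
  exact: (rho_lt_of_high_degree al01 s2 n7 k0 hl sE Gtp deg_v nis).
rewrite negb_exists => /forallP low.
exact: (rho_lt_of_low_degree Gtp n1 k0 low halpha s_ge).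
Qed.
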